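(* Let $n,s\in\mathbb{N}$ and let $q_n=x_1^2+\cdots+x_n^2$. The apolar ideal of the form $q_n^s$ is the ideal of $\mathbb{C}[y_1,\dots,y_n]$ generated by the harmonic homogeneous polynomials of degree $s+1$: $$\operatorname{Ann}(q_n^s)=(\mathcal{H}_{n,s+1}).$$
   Context: Let $\mathcal{R}_n=\mathbb{C}[x_1,\dots,x_n]$ and $\mathcal{D}_n=\mathbb{C}[y_1,\dots,y_n]$. The apolarity action $\circ\colon\mathcal{D}_n\times\mathcal{R}_n\to\mathcal{R}_n$ lets each $y_i$ act as $\partial/\partial x_i$, so $\phi\in\mathcal{D}_n$ acts as the constant-coefficient differential operator $\phi(\partial/\partial x_1,\dots,\partial/\partial x_n)$. For a homogeneous polynomial $f\in\mathcal{R}_n$, the apolar ideal is $\operatorname{Ann}(f)=\{\phi\in\mathcal{D}_n : \phi\circ f=0\}$. For $d\in\mathbb{N}$, $\mathcal{H}_{n,d}$ denotes the space of homogeneous polynomials $h$ of degree $d$ in $n$ variables with $\Delta h=0$, where $\Delta$ is the sum of the second partial derivatives with respect to the $n$ variables; here, identifying the variables $x_i$ with $y_i$, $\mathcal{H}_{n,s+1}$ is regarded as a subspace of $\mathcal{D}_n$ (i.e. polynomials $h$ in $y_1,\dots,y_n$ with $\sum_i\partial^2 h/\partial y_i^2=0$).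
   Formalization: The formal theorem assumes n ≥ 2 or s = 0; for n ≤ 1 and s ≥ 1 the claim is false, e.g. for n = 1 the space H_{1,s+1} is zero while Ann(x_1^{2s}) = (y_1^{2s+1}) is not. *)

(* Defs.v *)
From mathcomp Require Import all_boot all_order all_algebra.
From mathcomp Require Import reals.
From mathcomp Require Import complex mpoly.

Set Implicit Arguments.
Unset Strict Implicit.
Unset Printing Implicit Defensive.

Import GRing.Theory.
Local Open Scope ring_scope.

(* Both C[x_1, ..., x_n] and C[y_1, ..., y_n] are represented by the type
   {mpoly K[n]} (with K the field of complex numbers in the end); the role of
   a polynomial is determined by its position as an argument of apolar. *)
Section Apolarity.
Context {n : nat} {K : comNzRingType}.
Implicit Types (f phi h p : {mpoly K[n]}).

(* phi(d/dx_1, ..., d/dx_n) f, where [mderivm m f] is the iterated partial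
   derivative of f with multi-exponent m. *)
Definition apolar phi f : {mpoly K[n]} :=
  \sum_(m <- msupp phi) phi@_m *: mderivm m f.

Definition apolar_ideal f : {pred {mpoly K[n]}} :=
  [pred phi | apolar phi f == 0].

Definition laplacian h : {mpoly K[n]} := \sum_(i < n) mderiv i (mderiv i h).

(* [dhomog] counts 0 as homogeneous of every degree, so this is a subspace. *)
Definition harmonic_homog (d : nat) : {pred {mpoly K[n]}} :=
  [pred h | (h \is d.-homog) && (laplacian h == 0)].

Definition ideal_generated (A : {pred {mpoly K[n]}}) p : Prop :=
  exists (k : nat) (c g : 'I_k -> {mpoly K[n]}),
    (forall i, g i \in A) /\ p = \sum_(i < k) c i * g i.

End Apolarity.

Definition quadric (n : nat) (K : comNzRingType) : {mpoly K[n]} :=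
  \sum_(i < n) 'X_i ^+ 2.

(* Main.v *)
From HB Require Import structures.
Require Import Defs.
From mathcomp Require Import all_boot all_order all_algebra.
From mathcomp Require Import reals.
From mathcomp Require Import complex mpoly.
From mathcomp Require Import ssrcomplements ring.

Set Implicit Arguments.
Unset Strict Implicit.
Unset Printing Implicit Defensive.

Import GRing.Theory Num.Theory.

(** Write q for the quadric, H_k for the harmonic forms of degree k, and I for
    the ideal generated by H_(s+1).  Since q acts as the Laplacian, everything
    reduces to how q and H_k act on powers of q.  Two identities govern this.
    For h in H_k, Euler's identity and induction on k give
      h o q^s = 2^k s(s-1)...(s-k+1) q^(s-k) h
    ([apolar_harmonic_quadric_exp]), and the product rule gives
      Lap (q^(a+1) h) = 2(a+1)(n+2k+2a) q^a h
    ([laplacian_quadric_exp_harmonic]).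

    The first identity shows at once that H_(s+1) kills q^s, because the
    falling factorial vanishes for k = s+1; so I is contained in Ann(q^s).

    For the converse, every polynomial is a sum of terms q^j h with h harmonic:
    the span of these terms is stable under multiplication by x_i, because
    x_i h - (n+2k-2)^-1 q d_i h is again harmonic ([harmonic_mulXP]), where for
    k = 0 the second summand is zero.  The same harmonic polynomials satisfy
      sum_i x_i (x_i h - (n+2k-2)^-1 q d_i h) = (1 - k/(n+2k-2)) q h
    with scalar 1 for k = 0, and the scalar is nonzero when n >= 2 or k = 0,
    whence q H_k lies in the ideal of H_(k+1).  By Euler's identity H_(k+1) lies
    in the ideal of H_k.  Consequently q^j H_k lies in I as soon as j + k > s
    ([quadric_exp_harmonic_in_ideal]), and modulo I each polynomial is a sum
    of terms q^(s-a-k) h_(a,k) with a + k <= s ([all_expandable]).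

    For n > 0, the term q^(s-a-k) h_(a,k) applied to q^s gives a nonzero
    multiple of q^a h_(a,k) ([apolar_expansion_term]).  Sums of such polynomials
    vanish only when every h_(a,k) does ([harmonic_expansion_uniq]), so a
    polynomial annihilating q^s has zero expansion, that is, lies in I. *)

Local Open Scope ring_scope.

(** * The apolarity action as a module structure *)

Section ApolarAction.
Context {n : nat} {K : comNzRingType}.
Implicit Types (f p r : {mpoly K[n]}) (m : 'X_{1..n}).

(** Polynomials have different supports, so additivity in the operator is
    proved on a common finite index type, the monomials of bounded degree. *)
Lemma apolarwE k p f : (msize p <= k)%N ->
  apolar p f = \sum_(m : 'X_{1..n < k}) p@_m *: mderivm m f.
Proof.
move=> le_pk; pose I : subFinType _ := 'X_{1..n < k}.
rewrite /apolar (big_mksub I) /=; first last.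
- by move=> m /msize_mdeg_lt/leq_trans/(_ le_pk).
- exact: msupp_uniq.
by rewrite big_rmcond //= => m /memN_msupp_eq0 ->; rewrite scale0r.
Qed.

Lemma apolar_is_linear p : linear (apolar p).
Proof.
move=> c f g; rewrite /apolar scaler_sumr -big_split /=.
by apply: eq_bigr => m _; rewrite linearP scalerDr !scalerA mulrC.
Qed.

HB.instance Definition _ p := GRing.isLinear.Build K {mpoly K[n]} {mpoly K[n]}
  _ (apolar p) (apolar_is_linear p).

Lemma apolarPl c p r f : apolar (c *: p + r) f = c *: apolar p f + apolar r f.
Proof.
pose k := maxn (msize (c *: p + r)) (maxn (msize p) (msize r)).
rewrite !(@apolarwE k) ?leq_max ?leqnn ?orbT // scaler_sumr -big_split /=.
by apply: eq_bigr => m _; rewrite mcoeffD mcoeffZ scalerDl scalerA.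
Qed.

Lemma apolar0l f : apolar 0 f = 0.
Proof. by rewrite /apolar msupp0 big_nil. Qed.

Lemma apolarZl c p f : apolar (c *: p) f = c *: apolar p f.
Proof. by rewrite -[c *: p]addr0 apolarPl apolar0l addr0. Qed.

Lemma apolarDl p r f : apolar (p + r) f = apolar p f + apolar r f.
Proof. by rewrite -[p]scale1r apolarPl !scale1r. Qed.

Lemma apolar_suml I (s : seq I) (P : pred I) (F : I -> {mpoly K[n]}) f :
  apolar (\sum_(i <- s | P i) F i) f = \sum_(i <- s | P i) apolar (F i) f.
Proof.
by apply: (big_morph (apolar^~ f)) => [p r|]; [apply: apolarDl | apply: apolar0l].
Qed.

Lemma apolarXm m f : apolar 'X_[m] f = mderivm m f.
Proof. by rewrite /apolar msuppX big_seq1 mcoeffX eqxx scale1r. Qed.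

Lemma apolarX i f : apolar 'X_i f = mderiv i f.
Proof. by rewrite apolarXm mderivmU1m. Qed.

Lemma apolar1 f : apolar 1 f = f.
Proof. by rewrite -mpolyX0 apolarXm mderivm0m. Qed.

(** Composition of constant-coefficient operators is multiplication of their
    symbols: this is what makes the annihilator of [f] an ideal. *)
Lemma apolarM p r f : apolar (p * r) f = apolar p (apolar r f).
Proof.
elim/mpolyind: p => [|c m p _ _ IHp]; first by rewrite mul0r !apolar0l.
rewrite mulrDl -scalerAl !apolarPl IHp; congr (_ *: _ + _).
elim/mpolyind: r {IHp} => [|d m' r _ _ IHr].
  by rewrite mulr0 !apolar0l linear0.
rewrite mulrDr -scalerAr !apolarPl linearP IHr /=.
by rewrite -mpolyXD !apolarXm addmC mderivmDm.
Qed.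

End ApolarAction.

(** * Closure properties of generated ideals *)

Section GeneratedIdeal.
Context {n : nat} {K : comNzRingType}.
Implicit Types (A B : {pred {mpoly K[n]}}) (p g c : {mpoly K[n]}).

Lemma ideal_generated0 A : ideal_generated A 0.
Proof.
by exists 0, (fun=> 0), (fun=> 0); split; [case | rewrite big_ord0].
Qed.

Lemma ideal_generated_mem A g : g \in A -> ideal_generated A g.
Proof.
move=> Ag; exists 1, (fun=> 1), (fun=> g); split=> //.
by rewrite big_ord1 mul1r.
Qed.

Lemma ideal_generatedD A p r :
  ideal_generated A p -> ideal_generated A r -> ideal_generated A (p + r).
Proof.
move=> [k [c [g [Ag ->]]]] [l [d [h [Ah ->]]]].
exists (k + l), (fun i => match split i with inl j => c j | inr j => d j end).
exists (fun i => match split i with inl j => g j | inr j => h j end).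
split=> [i|]; first by case: (split i).
rewrite big_split_ord /=; congr (_ + _); apply: eq_bigr => i _.
  by rewrite (unsplitK (inl i)).
by rewrite (unsplitK (inr i)).
Qed.

Lemma ideal_generatedM A c p : ideal_generated A p -> ideal_generated A (c * p).
Proof.
move=> [k [d [g [Ag ->]]]]; exists k, (fun i => c * d i), g; split=> //.
by rewrite mulr_sumr; apply: eq_bigr => i _; rewrite mulrA.
Qed.

Lemma ideal_generatedZ A (a : K) p :
  ideal_generated A p -> ideal_generated A (a *: p).
Proof. by rewrite -mul_mpolyC; apply: ideal_generatedM. Qed.

Lemma ideal_generated_sum A I (s : seq I) (P : pred I) (F : I -> {mpoly K[n]}) :
  (forall i, P i -> ideal_generated A (F i)) ->
  ideal_generated A (\sum_(i <- s | P i) F i).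
Proof.
move=> AF; elim/big_rec: _ => [|i p Pi Ap]; first exact: ideal_generated0.
by apply: ideal_generatedD => //; apply: AF.
Qed.

(** The factor [c] lets one prove that c p lies in an ideal by inspecting only
    the products c g with generators [g]. *)
Lemma ideal_generated_trans A B c p :
  (forall g, g \in A -> ideal_generated B (c * g)) ->
  ideal_generated A p -> ideal_generated B (c * p).
Proof.
move=> AB [k [d [g [Ag ->]]]]; rewrite mulr_sumr; apply: ideal_generated_sum.
by move=> i _; rewrite mulrCA; apply/ideal_generatedM/AB.
Qed.

Lemma ideal_generated_apolar A f p :
  {in A, forall g, apolar g f = 0} -> ideal_generated A p -> apolar p f = 0.
Proof.
move=> Af [k [c [g [Ag ->]]]]; rewrite apolar_suml big1 // => i _.
by rewrite apolarM Af // linear0.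
Qed.

End GeneratedIdeal.

(** * The Laplacian and the quadric *)

Section Laplacian.
Context {n : nat} {K : comNzRingType}.
Implicit Types (f p r h : {mpoly K[n]}).

Local Notation q := (quadric n K).

Lemma laplacian_is_linear : linear (@laplacian n K).
Proof.
move=> c f g; rewrite /laplacian scaler_sumr -big_split /=.
by apply: eq_bigr => i _; rewrite !linearP.
Qed.

HB.instance Definition _ := GRing.isLinear.Build K {mpoly K[n]} {mpoly K[n]}
  _ (@laplacian n K) laplacian_is_linear.

Lemma laplacianM p r : laplacian (p * r) =
  laplacian p * r + (\sum_(i < n) mderiv i p * mderiv i r) *+ 2 + p * laplacian r.
Proof.
rewrite /laplacian mulr_suml mulr_sumr -sumrMnl -!big_split /=.
by apply: eq_bigr => i _; rewrite !(mderivM, mderivD); ring.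
Qed.

Lemma laplacian_mderiv i h : laplacian (mderiv i h) = mderiv i (laplacian h).
Proof.
rewrite /laplacian raddf_sum; apply: eq_bigr => j _.
by rewrite [mderiv j (mderiv i h)]mderiv_comm mderiv_comm.
Qed.

Lemma mderivX1 i j : mderiv i 'X_j = (i == j)%:R :> {mpoly K[n]}.
Proof.
rewrite mderivX mnm1E eq_sym; case: eqVneq => [->|_]; last by rewrite scale0r.
by rewrite -{1}[U_(j)%MM]add0m addmK mpolyX0 scale1r.
Qed.

Lemma mderiv_exp i p a : mderiv i (p ^+ a) = p ^+ a.-1 * mderiv i p *+ a.
Proof.
elim: a => [|a IHa]; first by rewrite expr0 -mpolyC1 mderivC mulr0n.
rewrite exprS mderivM {}IHa; case: a => [|a] /=; rewrite ?exprS; ring.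
Qed.

Lemma mderiv_quadric i : mderiv i q = 'X_i *+ 2.
Proof.
rewrite /quadric raddf_sum (bigD1 i) //= big1 ?addr0 => [|j ne_ji].
  by rewrite mderiv_exp mderivX1 eqxx mulr1.
by rewrite mderiv_exp mderivX1 eq_sym (negPf ne_ji) mulr0 mul0rn.
Qed.

Lemma laplacian_quadric : laplacian q = (2 * n)%:R.
Proof.
rewrite /laplacian (eq_bigr (fun=> 2%:R)) => [|i _].
  by rewrite sumr_const card_ord -mulrnA.
by rewrite mderiv_quadric raddfMn /= mderivX1 eqxx.
Qed.

Lemma apolar_quadric f : apolar q f = laplacian f.
Proof.
rewrite /quadric apolar_suml; apply: eq_bigr => i _.
by rewrite expr2 apolarM !apolarX.
Qed.

Lemma quadric_homog : q \is 2.-homog.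
Proof.
apply: rpred_sum => i _; rewrite -[2%N]/(1 * 2)%N; apply: dhomogMn.
by rewrite dhomogX /= mdeg1.
Qed.

Lemma mderiv_homog i d h : h \is d.-homog -> mderiv i h \is d.-1.-homog.
Proof.
move=> hd; apply/dhomogP => m; rewrite mcoeff_msupp mcoeff_mderiv => nz.
have /(dhomog_mf hd) <- : (m + U_(i))%MM \in msupp h.
  by rewrite mcoeff_msupp; apply: contraNneq nz => ->; rewrite mul0rn.
by rewrite /= mdegD mdeg1 addn1.
Qed.

Lemma homog0_const h : h \is 0.-homog -> h = (h@_0)%:MP.
Proof.
move=> h0; apply/mpolyP => m; rewrite mcoeffC.
case: eqVneq => [<-|nz_m]; first by rewrite mulr1.
by rewrite mulr0 (dhomog_nemf_coeff h0) //= mdeg_eq0.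
Qed.

Lemma euler_homog d h : h \is d.-homog ->
  \sum_(i < n) 'X_i * mderiv i h = d%:R *: h.
Proof.
move=> hd; rewrite [in RHS](mpolyE h) scaler_sumr.
under eq_bigr => i _ do rewrite {1}(mpolyE h) raddf_sum mulr_sumr.
rewrite exchange_big /= big_seq [RHS]big_seq; apply: eq_bigr => m hm.
rewrite -(dhomog_mf hd hm) scalerA mulrC -scalerA /= mdegE natr_sum scaler_suml.
rewrite scaler_sumr; apply: eq_bigr => i _.
rewrite mderivZ -scalerAr mderivX -scalerAr -mpolyXD.
case: (posnP (m i)) => [->|mi_gt0]; first by rewrite !scale0r.
by rewrite addmC submK // lep1mP -lt0n.
Qed.

(** The cross term of the product rule is 4 sum_i x_i d_i h, which Euler's
    identity evaluates. *)
Lemma laplacian_quadricM d h : h \is d.-homog ->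
  laplacian (q * h) = (2 * n + 4 * d)%:R *: h + q * laplacian h.
Proof.
move=> hd; rewrite laplacianM laplacian_quadric.
under eq_bigr => i _ do rewrite mderiv_quadric mulrnAl.
rewrite sumrMnl (euler_homog hd) -mulrnA !scaler_nat; ring.
Qed.

(** Summands of pairwise distinct degrees are separated by the projections to
    homogeneous components. *)
Lemma homog_sum_eq0 M (g : nat -> {mpoly K[n]}) :
  (forall k, g k \is k.-homog) -> \sum_(k < M) g k = 0 ->
  forall k, (k < M)%N -> g k = 0.
Proof.
move=> g_hom sum_g k lt_kM.
have := congr1 (pihomog mdeg k) sum_g; rewrite raddf_sum raddf0.
rewrite (bigD1 (Ordinal lt_kM)) //= big1 => [|i ne_ik].
  by rewrite addr0 pihomog_dE.
by rewrite (pihomog_ne0 _ (g_hom i)).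
Qed.

End Laplacian.

(** * Products of powers of the quadric with harmonic forms *)

(** The scalar relating the j-th Laplacian of q^(a+j) h to q^a h when h is
    harmonic of degree k; its factors are those of
    [laplacian_quadric_exp_harmonic]. *)
Definition quadric_coef n k a j : nat :=
  \prod_(i < j) (2 * (a + i).+1 * (n + 2 * k + 2 * (a + i))).

Section Harmonic.
Context {n : nat} {K : comNzRingType}.
Implicit Types (f p r h : {mpoly K[n]}).

Local Notation q := (quadric n K).
Local Notation H k := (@harmonic_homog n K k).

Lemma harmonic0 k : 0 \in H k.
Proof. by rewrite inE rpred0 linear0 eqxx. Qed.

Lemma harmonic1 : 1 \in H 0.
Proof.
by rewrite inE dhomog1 /laplacian big1 //= => i _; rewrite -mpolyC1 !mderivC.
Qed.

Lemma harmonicD k p r : p \in H k -> r \in H k -> p + r \in H k.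
Proof.
rewrite !inE => /andP[hp /eqP lp] /andP[hr /eqP lr].
by rewrite rpredD //= linearD /= lp lr addr0.
Qed.

Lemma harmonicZ k c h : h \in H k -> c *: h \in H k.
Proof.
by rewrite !inE => /andP[hh /eqP lh]; rewrite rpredZ //= linearZ /= lh scaler0.
Qed.

Lemma harmonic_mderiv k i h : h \in H k -> mderiv i h \in H k.-1.
Proof.
rewrite !inE => /andP[hh /eqP lh].
by rewrite mderiv_homog //= laplacian_mderiv lh linear0.
Qed.

(** Induction on [a] by [laplacian_quadricM], as q^(a+1) h is homogeneous of
    degree 2a+2+k and 2n + 4(2a+2+k) + 2(a+1)(n+2k+2a) = 2(a+2)(n+2k+2a+2). *)
Lemma laplacian_quadric_exp_harmonic a k h : h \in H k ->
  laplacian (q ^+ a.+1 * h) = (2 * a.+1 * (n + 2 * k + 2 * a))%:R *: (q ^+ a * h).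
Proof.
move=> /andP[hh /eqP lh].
have hom b : q ^+ b * h \is (2 * b + k).-homog.
  exact: dhomogM (dhomogMn _ quadric_homog) hh.
elim: a => [|a IHa].
  by rewrite expr1 expr0 mul1r (laplacian_quadricM hh) lh mulr0 !scaler_nat; ring.
rewrite exprS -mulrA (laplacian_quadricM (hom _)) IHa exprS.
rewrite !scaler_nat; ring.
Qed.

Lemma apolar_quadric_exp_harmonic j a k h : h \in H k ->
  apolar (q ^+ j) (q ^+ (a + j) * h) = (quadric_coef n k a j)%:R *: (q ^+ a * h).
Proof.
move=> hh; elim: j a => [|j IHj] a.
  by rewrite /quadric_coef big_ord0 addn0 scale1r apolar1.
rewrite exprS apolarM addnS -addSn IHj linearZ /= apolar_quadric.
rewrite (laplacian_quadric_exp_harmonic _ hh) scalerA -natrM mulnC.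
rewrite /quadric_coef big_ord_recl addn0.
by congr ((_ * _)%:R *: _); apply: eq_bigr => i _; rewrite lift0 addSnnS.
Qed.

(** After [a] Laplacians only a multiple of [h] is left, and the next one kills
    it. *)
Lemma apolar_quadric_exp_harmonic_eq0 j a k h : (a < j)%N -> h \in H k ->
  apolar (q ^+ j) (q ^+ a * h) = 0.
Proof.
move=> lt_aj hh; have /andP[_ /eqP lap_h] := hh.
rewrite -(subnK lt_aj) exprD exprS !apolarM.
rewrite -[X in q ^+ X * h]add0n (apolar_quadric_exp_harmonic _ _ hh) expr0 mul1r.
by rewrite apolar_quadric linearZ /= lap_h scaler0 linear0.
Qed.

End Harmonic.

(** * Harmonic forms acting on powers of the quadric *)

Section HarmonicAction.
Context {n : nat} {K : numFieldType}.
Implicit Types (f p r h : {mpoly K[n]}).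

Local Notation q := (quadric n K).
Local Notation H k := (@harmonic_homog n K k).

Lemma quadric_coef_neq0 k a j : (0 < n)%N -> (quadric_coef n k a j)%:R != 0 :> K.
Proof.
move=> n_gt0; rewrite pnatr_eq0 -lt0n; apply: prodn_gt0 => i.
by rewrite !muln_gt0 -addnA addn_gt0 n_gt0.
Qed.

(** By Euler's identity (k+1) h = sum_i x_i d_i h with each d_i h in H_k, so
    (k+1) h o q^s is the sum of the derivatives d_i of a multiple of
    q^(s-k) d_i h.  Differentiating the power of q gives Euler's sum again,
    hence a multiple of q^(s-k-1) h; differentiating d_i h gives the Laplacian
    of [h], which is zero. *)
Lemma apolar_harmonic_quadric_exp k s h : h \in H k ->
  apolar h (q ^+ s) = (2 ^ k * s ^_ k)%:R *: (q ^+ (s - k) * h).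
Proof.
elim: k h => [|k IHk] h hh.
  move/andP: hh => [/homog0_const -> _].
  rewrite ffactn0 expn0 scale1r subn0 [_ * _%:MP]mulrC mul_mpolyC.
  by rewrite -[_%:MP]mulr1 mul_mpolyC apolarZl apolar1.
have /andP[hom_h /eqP lap_h] := hh.
have nzk : k.+1%:R != 0 :> K by rewrite pnatr_eq0.
apply: (scalerI nzk).
rewrite -apolarZl -(euler_homog hom_h) apolar_suml.
under eq_bigr => i _.
  rewrite apolarM apolarX (IHk _ (harmonic_mderiv i hh)) mderivZ mderivM.
  rewrite mderiv_exp mderiv_quadric.
  over.
rewrite -scaler_sumr big_split /= -mulr_sumr.
rewrite -[\sum_(i < n) mderiv i (mderiv i h)]/(laplacian h) lap_h mulr0 addr0.
have -> : \sum_(i < n) q ^+ (s - k).-1 * ('X_i *+ 2) *+ (s - k) * mderiv i h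
    = (2 * (s - k))%:R *: (q ^+ (s - k).-1 * (k.+1%:R *: h)).
  rewrite -(euler_homog hom_h) mulr_sumr scaler_sumr; apply: eq_bigr => i _.
  by rewrite scaler_nat; ring.
rewrite scalerA -natrM -subnS expnS ffactnSr -scalerAr scalerA mulrC -scalerA.
by congr (_ *: (_%:R *: _)); ring.
Qed.

(** * Multiplication of harmonic forms by variables *)

(** The harmonic part of x_i h.  The truncated subtraction is exact for k > 0
    since [i] forces n > 0; for k = 0 the second summand is zero because [h] is
    constant. *)
Definition harmonic_mulX i k h : {mpoly K[n]} :=
  'X_i * h - (n + k.*2 - 2)%:R^-1 *: (q * mderiv i h).

(** For k > 0, Lap (x_i h) = 2 d_i h and Lap (q d_i h) = 2(n+2k-2) d_i h. *)
Lemma harmonic_mulXP i k h : h \in H k -> harmonic_mulX i k h \in H k.+1.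
Proof.
move=> hh; have /andP[hom_h /eqP lap_h] := hh.
have /andP[hom_dh /eqP lap_dh] := harmonic_mderiv i hh.
have lap_Xh : laplacian ('X_i * h) = mderiv i h *+ 2.
  rewrite laplacianM lap_h mulr0 addr0 (bigD1 i) //= big1 => [|j ne_ji].
    rewrite mderivX1 eqxx mul1r addr0 /laplacian big1 ?mul0r ?add0r // => j _.
    by rewrite mderivX1 -mpolyC_nat mderivC.
  by rewrite mderivX1 (negPf ne_ji) mul0r.
have lap_P c : laplacian ('X_i * h - c *: (q * mderiv i h)) =
    mderiv i h *+ 2 - c *: ((2 * n + 4 * k.-1)%:R *: mderiv i h).
  rewrite [LHS]linearB [X in _ - X]linearZ /= lap_Xh (laplacian_quadricM hom_dh).
  by rewrite lap_dh mulr0 addr0.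
rewrite inE /harmonic_mulX lap_P.
have homX : 'X_i \is [in K[n], 1.-homog] by rewrite dhomogX /= mdeg1.
case: k => [|k] in hh hom_h hom_dh lap_dh lap_P *.
  have -> : mderiv i h = 0 by rewrite (homog0_const hom_h) mderivC.
  rewrite !(mulr0, scaler0, addr0, subr0, mul0rn) eqxx andbT.
  exact: (dhomogM homX hom_h).
apply/andP; split.
  apply: rpredB; first exact: (dhomogM homX hom_h).
  by apply: rpredZ; exact: (dhomogM quadric_homog hom_dh).
rewrite /= scalerA doubleS addnS addnS subn2 /=.
have -> : (2 * n + 4 * k = (n + k.*2) * 2)%N by rewrite -muln2; ring.
rewrite natrM mulrA mulVf ?mul1r ?scaler_nat ?subrr //.
by rewrite pnatr_eq0 addn_eq0 negb_and -lt0n (leq_ltn_trans _ (ltn_ord i)).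
Qed.

(** * Terms q^j h of the ideal generated by harmonic forms *)

(** The sum over [i] of x_i times the harmonic part of x_i h is
    (1 - k/(n+2k-2)) q h for k > 0 and q h for k = 0.  For n, k > 0 the scalar
    vanishes only at n = k = 1, where indeed q x = x^3 while H_2 = 0. *)
Lemma quadric_harmonic_in_ideal k h : (1 < n)%N \/ k = 0%N -> h \in H k ->
  ideal_generated (H k.+1) (q * h).
Proof.
move=> n_k hh; have /andP[hom_h _] := hh.
pose e : K := 1 - (n + k.*2 - 2)%:R^-1 * k%:R.
have nz_e : e != 0.
  case: n_k => [n_gt1|k0]; last by rewrite /e k0 mulr0 subr0 oner_eq0.
  case: k @e {hh hom_h} => [|k] e; first by rewrite /e mulr0 subr0 oner_eq0.
  have lt_k : (k.+1 < n + k.+1.*2 - 2)%N.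
    rewrite doubleS !addnS subn2 /= -addnn.
    exact: leq_add n_gt1 (leq_addr k k).
  rewrite /e; set m := (n + _ - 2)%N in lt_k *.
  have nz_m : m%:R != 0 :> K by rewrite pnatr_eq0 -lt0n (leq_ltn_trans _ lt_k).
  rewrite subr_eq0; apply: contraTneq lt_k => e1.
  have /eqP : m%:R = k.+1%:R :> K by rewrite -[RHS](mulVKf nz_m) -e1 mulr1.
  by rewrite eqr_nat => /eqP ->; rewrite ltnn.
have -> : q * h = e^-1 *: \sum_(i < n) 'X_i * harmonic_mulX i k h.
  apply: (scalerI nz_e); rewrite scalerA mulfV // scale1r.
  under [RHS]eq_bigr => i _ do rewrite mulrBr -scalerAr (mulrCA _ q).
  rewrite big_split /= sumrN -scaler_sumr -mulr_sumr (euler_homog hom_h).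
  rewrite scalerBl scale1r -scalerAr scalerA; congr (_ - _).
  by rewrite /quadric mulr_suml; apply: eq_bigr => i _; rewrite expr2 mulrA.
apply/ideal_generatedZ/ideal_generated_sum => i _.
by apply/ideal_generatedM/ideal_generated_mem/harmonic_mulXP.
Qed.

(** Euler's identity expresses [h] through its partial derivatives, which are
    harmonic of degree one less. *)
Lemma harmonic_in_ideal k l h : (k <= l)%N -> h \in H l ->
  ideal_generated (H k) h.
Proof.
elim: l h => [|l IHl] h.
  by rewrite leqn0 => /eqP ->; exact: ideal_generated_mem.
rewrite leq_eqVlt => /predU1P[-> | lt_kl] hh; first exact: ideal_generated_mem.
have /andP[hom_h _] := hh.
have -> : h = l.+1%:R^-1 *: \sum_(i < n) 'X_i * mderiv i h.
  by rewrite (euler_homog hom_h) scalerA mulVf ?scale1r // pnatr_eq0.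
apply/ideal_generatedZ/ideal_generated_sum => i _; apply: ideal_generatedM.
exact/IHl/(harmonic_mderiv i hh).
Qed.

(** Each factor q can be traded for one more degree of harmonicity until the
    degree exceeds [s].  Only forms of degree at most [s] are traded, so for
    s = 0 they are constants, as [quadric_harmonic_in_ideal] asks when n <= 1. *)
Lemma quadric_exp_harmonic_in_ideal s j k h : (1 < n)%N \/ s = 0%N ->
  (s < j + k)%N -> h \in H k -> ideal_generated (H s.+1) (q ^+ j * h).
Proof.
move=> n_s; elim: j k h => [|j IHj] k h lt_s hh.
  by rewrite mul1r; apply: harmonic_in_ideal hh.
case: (ltnP s k) => [lt_sk|le_ks].
  exact/ideal_generatedM/(harmonic_in_ideal lt_sk hh).
rewrite exprSr -mulrA; apply: (@ideal_generated_trans _ _ (H k.+1)).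
  by move=> g hg; apply: IHj hg; rewrite addnS -addSn.
apply: quadric_harmonic_in_ideal => //.
by case: n_s => [|s0]; [left | right; move: le_ks; rewrite s0 leqn0 => /eqP].
Qed.

(** * Expansions in powers of the quadric *)

(** Applying the highest power of q that occurs kills the terms with lower
    powers, and turns those with the highest power into nonzero multiples of harmonic forms of distinct
    degrees.  Hence they vanish, and one descends.  The bound [M] may depend on
    the power of q because the expansions below range over a triangle. *)
Lemma harmonic_expansion_uniq N (M : nat -> nat) (h : nat -> nat -> {mpoly K[n]}) :
  (0 < n)%N -> (forall a k, h a k \in H k) ->
  \sum_(a < N) \sum_(k < M a) q ^+ a * h a k = 0 ->
  forall a k, (a < N)%N -> (k < M a)%N -> h a k = 0.
Proof.
move=> n_gt0 hh; elim: N => // N IHN; rewrite big_ord_recr /= => sum0.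
have top0 k : (k < M N)%N -> h N k = 0.
  move=> lt_k.
  have := congr1 (apolar (q ^+ N)) sum0; rewrite linear0 linearD /= !linear_sum /=.
  rewrite big1 ?add0r => [|a _]; last first.
    rewrite linear_sum big1 // => l _.
    exact: apolar_quadric_exp_harmonic_eq0 (ltn_ord a) (hh _ _).
  under eq_bigr => l _ do
    rewrite -[X in q ^+ X * _]add0n (apolar_quadric_exp_harmonic _ _ (hh _ _)) mul1r.
  move=> /(homog_sum_eq0 (g := fun l => (quadric_coef n l 0 N)%:R *: h N l)) h0.
  apply: (scalerI (quadric_coef_neq0 k 0 N n_gt0)); rewrite scaler0 h0 // => l.
  by apply: rpredZ; case/andP: (hh N l).
move=> a k; rewrite ltnS leq_eqVlt => /predU1P[-> | lt_aN]; first exact: top0.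
apply: IHN => //; rewrite -[RHS]sum0 [X in _ = _ + X]big1 ?addr0 // => l _.
by rewrite top0 ?mulr0.
Qed.

(** First q^j lowers q^(a+k+j) to q^(a+k), and then [h] lowers that to
    q^a h. *)
Lemma apolar_expansion_term j a k h : h \in H k ->
  apolar (q ^+ j * h) (q ^+ (a + k + j)) =
  (quadric_coef n 0 (a + k) j * (2 ^ k * (a + k) ^_ k))%:R *: (q ^+ a * h).
Proof.
move=> hh.
rewrite mulrC apolarM -[q ^+ (a + k + j)]mulr1.
rewrite (apolar_quadric_exp_harmonic _ _ harmonic1).
rewrite mulr1 linearZ /= (apolar_harmonic_quadric_exp _ hh) addnK.
by rewrite scalerA -natrM.
Qed.

(** The terms are indexed by the power a of q that is left after the action on
    q^s, rather than by the exponent s - a - k, so that the image of an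
    expansion has the shape of [harmonic_expansion_uniq]. *)
Definition harmonic_expansion s (h : nat -> nat -> {mpoly K[n]}) : {mpoly K[n]} :=
  \sum_(a < s.+1) \sum_(k < s.+1 - a) q ^+ (s - a - k) * h a k.

Definition expandable s p : Prop :=
  exists2 h, forall a k, h a k \in H k &
    ideal_generated (H s.+1) (p - harmonic_expansion s h).

Lemma expandable_ideal s p : ideal_generated (H s.+1) p -> expandable s p.
Proof.
exists (fun _ _ => 0) => [a k|]; first exact: harmonic0.
rewrite /harmonic_expansion big1 ?subr0 // => a _.
by rewrite big1 // => k _; rewrite mulr0.
Qed.

Lemma expandableD s p r : expandable s p -> expandable s r -> expandable s (p + r).
Proof.
move=> [g hg Ip] [h hh Ir]; exists (fun a k => g a k + h a k) => [a k|].
  exact: harmonicD.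
have -> : harmonic_expansion s (fun a k => g a k + h a k) =
    harmonic_expansion s g + harmonic_expansion s h.
  rewrite -big_split; apply: eq_bigr => a _ /=; rewrite -big_split.
  by apply: eq_bigr => k _ /=; rewrite mulrDr.
by rewrite opprD addrACA; apply: ideal_generatedD.
Qed.

Lemma expandable_sum s I (l : seq I) (P : pred I) (F : I -> {mpoly K[n]}) :
  (forall i, P i -> expandable s (F i)) ->
  expandable s (\sum_(i <- l | P i) F i).
Proof.
move=> expF; elim/big_rec: _ => [|i p Pi exp_p].
  exact/expandable_ideal/ideal_generated0.
by apply: expandableD => //; apply: expF.
Qed.

(** Either j + k <= s, and the term occurs in the expansion at a = s - (j + k),
    or it belongs to the ideal. *)
Lemma expandable_quadric_harmonic s j k h : (1 < n)%N \/ s = 0%N -> h \in H k ->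
  expandable s (q ^+ j * h).
Proof.
move=> n_s hh; case: (ltnP s (j + k)) => [lt_s|le_s].
  exact/expandable_ideal/(quadric_exp_harmonic_in_ideal n_s lt_s hh).
have lt_a : (s - (j + k) < s.+1)%N by rewrite ltnS leq_subr.
have lt_k : (k < s.+1 - Ordinal lt_a)%N.
  by rewrite /= subSn ?leq_subr // ltnS subKn // leq_addl.
pose a0 := Ordinal lt_a; pose k0 := Ordinal lt_k.
exists (fun a l => if (a == s - (j + k))%N && (l == k) then h else 0) => [a l|].
  by case: andP => [[_ /eqP ->] //|_]; apply: harmonic0.
set e := harmonic_expansion _ _; suff -> : e = q ^+ j * h.
  by rewrite subrr; apply: ideal_generated0.
rewrite /e /harmonic_expansion (bigD1 a0) //= [X in _ + X]big1 ?addr0 => [|a ne_a].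
  rewrite (bigD1 k0) //= !eqxx [X in _ + X]big1 ?addr0 => [|l ne_l].
    by rewrite subKn // addnK.
  by rewrite [_ == k](negPf ne_l) mulr0.
by rewrite big1 // => l _; rewrite [nat_of_ord a == _](negPf ne_a) mulr0.
Qed.

(** Splitting x_i h into its harmonic part and a multiple of q d_i h turns x_i
    times a term q^j h into a sum of two terms of the same kind. *)
Lemma expandableX s i p : (1 < n)%N \/ s = 0%N ->
  expandable s p -> expandable s ('X_i * p).
Proof.
move=> n_s [h hh Ip]; rewrite -(subrK (harmonic_expansion s h) p) mulrDr.
apply: expandableD; first exact/expandable_ideal/ideal_generatedM.
rewrite mulr_sumr; apply: expandable_sum => a _.
rewrite mulr_sumr; apply: expandable_sum => k _.
set j := (s - a - k)%N.
have -> : 'X_i * (q ^+ j * h a k) = q ^+ j * harmonic_mulX i k (h a k) +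
    q ^+ j.+1 * ((n + k.*2 - 2)%:R^-1 *: mderiv i (h a k)).
  by rewrite mulrCA exprSr -mulrA -mulrDr -scalerAr subrK.
apply: expandableD; first exact/expandable_quadric_harmonic/harmonic_mulXP.
exact/expandable_quadric_harmonic/harmonicZ/harmonic_mderiv.
Qed.

Lemma all_expandable s p : (1 < n)%N \/ s = 0%N -> expandable s p.
Proof.
move=> n_s; rewrite (mpolyE p); apply: expandable_sum => m _.
rewrite mpolyXE_id -[_ *: _]mulr1 -scalerAl scalerAr.
have exp_c : expandable s (p@_m *: 1).
  rewrite -[_ *: 1]mul1r -(expr0 q).
  apply: (@expandable_quadric_harmonic _ _ 0) => //; exact/harmonicZ/harmonic1.
elim/big_rec: _ => [|i r _ exp_r]; first by rewrite mul1r.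
elim: (m i) => [|e IHe]; first by rewrite mul1r.
by rewrite exprS -!mulrA; apply: expandableX => //; rewrite mulrA.
Qed.

Lemma apolar_quadric_exp_ideal s p :
  ideal_generated (H s.+1) p -> apolar p (q ^+ s) = 0.
Proof.
apply: ideal_generated_apolar => h hh.
by rewrite (apolar_harmonic_quadric_exp _ hh) ffact_small // muln0 scale0r.
Qed.

Lemma ideal_apolar_quadric_exp s p : (0 < n)%N -> (1 < n)%N \/ s = 0%N ->
  apolar p (q ^+ s) = 0 -> ideal_generated (H s.+1) p.
Proof.
move=> n_gt0 n_s ap_p; have [h hh Ip] := all_expandable p n_s.
pose c a k := (quadric_coef n 0 (a + k) (s - a - k) * (2 ^ k * (a + k) ^_ k))%N.
have nz_c a k : (c a k)%:R != 0 :> K.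
  rewrite /c !natrM !mulf_neq0 ?quadric_coef_neq0 ?pnatr_eq0 ?expn_eq0 //.
  by rewrite -lt0n ffact_gt0 leq_addl.
suff h0 a k : (a < s.+1)%N -> (k < s.+1 - a)%N -> h a k = 0.
  move: Ip; rewrite /harmonic_expansion big1 ?subr0 // => a _.
  by rewrite big1 // => k _; rewrite h0 ?mulr0.
move=> lt_a lt_k; apply: (scalerI (nz_c a k)); rewrite scaler0.
apply: (@harmonic_expansion_uniq s.+1 (fun a => s.+1 - a)%N
  (fun a k => (c a k)%:R *: h a k)) => // [b l|]; first exact: harmonicZ.
transitivity (apolar (harmonic_expansion s h) (q ^+ s)); last first.
  have := apolar_quadric_exp_ideal Ip.
  rewrite addrC -scaleN1r apolarPl ap_p addr0 scaleN1r => /eqP.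
  by rewrite oppr_eq0 => /eqP.
rewrite apolar_suml; apply: eq_bigr => -[b lt_b] _ /=.
rewrite apolar_suml; apply: eq_bigr => -[l lt_l] _ /=.
rewrite -scalerAr /c -(apolar_expansion_term _ _ (hh b l)) -subnDA subnKC //.
by move: lt_l; rewrite ltn_subRL ltnS.
Qed.

End HarmonicAction.

(** * The apolar ideal *)

Theorem theorem3p28 (R : realType) (n s : nat) (hn : (1 < n)%N \/ s = 0%N) :
  forall phi : {mpoly R[i][n]},
    phi \in apolar_ideal (quadric n R[i] ^+ s) <->
    ideal_generated (harmonic_homog s.+1) phi.
Proof.
move=> phi; split=> [/eqP ap_phi|I_phi]; last first.
  exact/eqP/apolar_quadric_exp_ideal.
(* Without variables the scalars in the Laplacian identity may vanish; but then
   s = 0 and polynomials are constants. *)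
case: (posnP n) => [n0|n_gt0]; last exact: ideal_apolar_quadric_exp.
case: hn => [n_gt1|s0]; first by rewrite n0 in n_gt1.
suff -> : phi = 0 by apply: ideal_generated0.
have phi_const : phi = (phi@_0)%:MP.
  apply: homog0_const; apply/dhomogP => m _.
  by rewrite /= mdegE big1 // => i; have := ltn_ord i; rewrite {2}n0.
move: ap_phi; rewrite s0 expr0 phi_const -[_%:MP]mulr1 mul_mpolyC.
by rewrite apolarZl apolar1.
Qed.
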